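(* Let $G$ be a deterministic automaton over a finite event set $E$ with uncontrollable events $E_{uc}\subseteq E$, let $d$ be a metric on $E$ with values in $[0,1]$, let $\lambda\in[0,1]$, and let $K\subseteq L(G)$ be a nonempty prefix closed language. Then the Optimal Control Problem (OCP) for $(K,\lambda)$ has a solution if and only if $K$ is $\lambda$-controllable.
   Context: Setting. $E$ is a finite set of events, partitioned as $E=E_c\sqcup E_{uc}$ (controllable / uncontrollable events); $E^*$ is the set of finite strings over $E$ including the empty string $\epsilon$; $l(s)$ is the length of a string $s$; $\overline{L}$ is the prefix closure of a language $L\subseteq E^*$. $G=(Q,E,\delta,q_0)$ is a deterministic automaton with partial transition function $\delta:Q\times E\to Q$, extended to strings as usual, and $L(G)=\{s\in E^*:\delta(q_0,s)\text{ is defined}\}$ (a prefix closed language containing $\epsilon$). Metrics. $d$ is a metric on $E$ with values in $[0,1]$. Set $d(\epsilon,\epsilon)=0$ and $d(a,\epsilon)=d(\epsilon,a)=1$ for $a\in E$. For strings $s=s_1\cdots s_{l(s)}$, $t=t_1\cdots t_{l(t)}$, pad the shorter one with $\epsilon$'s and define $d(s,t)=\sum_{i=1}^{\max\{l(s),l(t)\}}2^{-i}d(s_i,t_i)$. For a string $s$ and a language $A$, $d(s,A)=\inf_{a\in A}d(s,a)$ if $A\neq\emptyset$ and $d(s,\emptyset)=1$. For languages $A,B$, $d(A,B)$ is the Hausdorff metric: $d(\emptyset,\emptyset)=0$, and otherwise $d(A,B)=\max\{\sup_{a\in A}d(a,B),\sup_{b\in B}d(b,A)\}$ (a supremum over the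 empty set being $0$). Controllability. A language $K\subseteq L(G)$ is controllable if $\overline{K}E_{uc}\cap L(G)\subseteq\overline{K}$. A language $K\subseteq L(G)$ is $\lambda$-controllable if there is a controllable language $\widetilde K\subseteq L(G)$ with $d(\widetilde K,K)\le\lambda$. Supervisors. A supervisor is a map $S:L(G)\to 2^E$ with $S(s)\supseteq E_{uc}$ for all $s\in L(G)$. The language $L(S/G)$ generated by the controlled system is defined recursively by $\epsilon\in L(S/G)$, and $s\sigma\in L(S/G)$ (with $\sigma\in E$) iff $s\in L(S/G)$, $s\sigma\in L(G)$ and $\sigma\in S(s)$. It is a known fact that a nonempty $M\subseteq L(G)$ is controllable iff there is a supervisor $S$ with $L(S/G)=\overline{M}$. OCP for $(K,\lambda)$: find a supervisor $S$ such that (i) $d(L(S/G),K)\le\lambda$, and (ii) $L(S/G)$ is Pareto optimal with respect to $CEM(S)=L(S/G)\cap K$ and $DEM(S)=L(S/G)\setminus K$. Pareto optimality means that any possible enlargement of $CEM(S)$ is necessarily accompanied by an enlargement of $DEM(S)$, and any possible reduction of $DEM(S)$ is necessarily accompanied by a reduction of $CEM(S)$; i.e. there is no supervisor $S'$ with $d(L(S'/G),K)\le\lambda$, $CEM(S')\supseteq CEM(S)$ and $DEM(S')\subseteq DEM(S)$ with at least one of the two inclusions strict. *)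

(* Defs.v *)
From HB Require Import structures.
From mathcomp Require Import all_boot all_order all_algebra.
From mathcomp Require Import all_classical all_reals.

Set Implicit Arguments.
Unset Strict Implicit.
Unset Printing Implicit Defensive.

Import Order.TTheory GRing.Theory Num.Theory.

Local Open Scope classical_set_scope.
Local Open Scope ring_scope.

(* Strings over E are [seq E]; languages are sets of strings. *)

(* The state set may be infinite; [trans q a = None] means undefined. *)
Record automaton (E : finType) := Automaton {
  state : Type;
  trans : state -> E -> option state;
  init : state }.

Section Languages.
Variable E : finType.
Implicit Types (G : automaton E) (Euc : {set E}) (K L M : set (seq E)).

Fixpoint run G (q : state G) (s : seq E) : option (state G) :=
  if s is a :: s' then
    if trans q a is Some q' then run q' s' else None
  else Some q.

Definition accepted G (s : seq E) : bool := isSome (run (init G) s).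

Definition lang G : set (seq E) := [set s | accepted G s].

Definition pclosure L : set (seq E) := [set s | exists2 t, L t & prefix s t].

(* The concatenation of L with a set A of events. *)
Definition catE L (A : {set E}) : set (seq E) :=
  [set t | exists s a, [/\ L s, a \in A & t = rcons s a]].

(* E_c does not occur: it is the complement of Euc. *)
Definition controllable G Euc K : Prop :=
  K `<=` lang G /\ catE (pclosure K) Euc `&` lang G `<=` pclosure K.

(* Maps L(G) -> 2^E. *)
Definition control_map G := {s : seq E | accepted G s} -> {set E}.

Definition supervisor G Euc (S : control_map G) : Prop :=
  forall s, Euc \subset S s.

Inductive closed_loop G (S : control_map G) : seq E -> Prop :=
| closed_loop_nil : closed_loop S [::]
| closed_loop_rcons s (Gs : accepted G s) a :
    closed_loop S s -> lang G (rcons s a) -> a \in S (exist _ s Gs) ->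
    closed_loop S (rcons s a).

Definition CEM G K (S : control_map G) : set (seq E) := closed_loop S `&` K.

Definition DEM G K (S : control_map G) : set (seq E) := closed_loop S `\` K.

End Languages.

Section Metrics.
Variables (R : realType) (E : finType).
Implicit Types (d : E -> E -> R) (s t : seq E) (A B K : set (seq E)).

Definition unit_metric d : Prop :=
  [/\ forall a b, 0 <= d a b <= 1,
      forall a b, d a b = 0 <-> a = b,
      forall a b, d a b = d b a
    & forall a b c, d a c <= d a b + d b c].

(* [None] stands for the padding symbol epsilon. *)
Definition dletter d (a b : option E) : R :=
  match a, b with
  | Some x, Some y => d x y
  | None, None => 0
  | _, _ => 1
  end.

(* [onth s i] is [None] beyond the end of s, which does the padding; letters
   are numbered from 0, hence the exponent [i.+1]. *)
Definition dstring d s t : R :=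
  \sum_(i < maxn (size s) (size t)) 2 ^- i.+1 * dletter d (onth s i) (onth t i).

Definition dpoint d s A : R :=
  if A == set0 then 1 else inf [set dstring d s a | a in A].

(* [sup set0 = 0], so no separate case is needed for empty languages; in
   particular the distance from set0 to itself is 0. *)
Definition dlang d A B : R :=
  Num.max (sup [set dpoint d a B | a in A]) (sup [set dpoint d b A | b in B]).

Definition lambda_controllable d (G : automaton E) (Euc : {set E}) (lam : R) K
    : Prop :=
  K `<=` lang G /\
  exists2 K', controllable G Euc K' & dlang d K' K <= lam.

Definition pareto_optimal d (G : automaton E) (Euc : {set E}) (lam : R) K
    (S : control_map G) : Prop :=
  ~ exists S' : control_map G,
      [/\ supervisor Euc S',
          dlang d (closed_loop S') K <= lam,
          CEM K S `<=` CEM K S',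
          DEM K S' `<=` DEM K S
        & CEM K S `<` CEM K S' \/ DEM K S' `<` DEM K S].

Definition OCP_solution d (G : automaton E) (Euc : {set E}) (lam : R) K
    (S : control_map G) : Prop :=
  [/\ supervisor Euc S,
      dlang d (closed_loop S) K <= lam
    & pareto_optimal d Euc lam K S].

End Metrics.

(* Main.v *)
Require Import Defs.
From mathcomp Require Import all_boot all_order all_algebra.
From mathcomp Require Import all_classical all_reals.

(** Only prefix closed languages matter: truncating two strings at the same
    length decreases their distance, so passing from K' to its prefix closure
    keeps it within lambda of the prefix closed K, and the distance from b to a
    prefix closed language is attained at a string no longer than b, hence is
    a minimum over a finite set.

    A Pareto optimum is a maximal element for the order "larger intersection
    with K, smaller difference with K" on the admissible languages.  Along a
    chain, every string is eventually in or eventually out, and the strings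
    that are eventually in form an upper bound of the chain.
    Admissibility passes to this limit; the only delicate point is that each b
    in K stays within lambda of it, and there the finite set of candidates
    decides at a single stage of the chain. *)

Set Implicit Arguments.
Unset Strict Implicit.
Unset Printing Implicit Defensive.

Import Order.TTheory GRing.Theory Num.Theory.

Local Open Scope classical_set_scope.
Local Open Scope ring_scope.

(** * Prefix closures of languages *)

Section PrefixClosure.
Variable E : finType.
Implicit Types (s t : seq E) (K M : set (seq E)).

Lemma pclosure_sub M : M `<=` pclosure M.
Proof. by move=> s Ms; exists s; rewrite ?prefix_refl. Qed.

Lemma pclosure_idem M : pclosure (pclosure M) = pclosure M.
Proof.
apply/seteqP; split=> [s [t [u Mu tu] st]|]; last exact: pclosure_sub.
by exists u => //; apply: prefix_trans st tu.
Qed.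

Lemma pclosure_take M s n : pclosure M s -> pclosure M (take n s).
Proof.
move=> Ms; rewrite -pclosure_idem; exists s => //.
exact: prefix_take.
Qed.

Lemma pclosure_nil M : M !=set0 -> pclosure M [::].
Proof. by case=> s Ms; exists s; rewrite ?prefix0s. Qed.

Lemma run_cat (G : automaton E) (q : state G) s t :
  run q (s ++ t) = if run q s is Some q' then run q' t else None.
Proof. by elim: s q => [|a s IH] q //=; case: (trans q a). Qed.

Lemma pclosure_lang (G : automaton E) : pclosure (lang G) = lang G.
Proof.
apply/seteqP; split; last exact: pclosure_sub.
move=> s [t + /prefixP[u tE]]; rewrite {}tE /lang /= /accepted run_cat.
by case: (run _ s).
Qed.

Lemma prefix_rconsP s t a : prefix s (rcons t a) -> s = rcons t a \/ prefix s t.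
Proof.
case/prefixP => u; case/lastP: u => [|u b]; first by rewrite cats0; left.
by rewrite -rcons_cat => /rcons_inj[-> _]; right; exact: prefix_prefix.
Qed.

Lemma pclosure_rcons M s a : pclosure M = M -> M (rcons s a) -> M s.
Proof. by move=> <- Msa; rewrite -pclosure_idem; exists (rcons s a); rewrite ?prefix_rcons. Qed.

End PrefixClosure.

(** * Distances between strings and languages *)

Section Distances.
Variables (R : realType) (E : finType) (d : E -> E -> R).
Hypothesis hd : unit_metric d.
Implicit Types (s t b : seq E) (A B : set (seq E)) (c : R).

Lemma dletter_bounds (x y : option E) : 0 <= dletter d x y <= 1.
Proof. by case: hd => h _ _ _; case: x y => [x|] [y|] //=; rewrite ?lexx ?ler01. Qed.

Lemma dterm_ge0 i (x y : option E) : 0 <= 2 ^- i.+1 * dletter d x y.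
Proof.
by case/andP: (dletter_bounds x y) => h _; rewrite mulr_ge0 // invr_ge0 exprn_ge0.
Qed.

Lemma dstring_ge0 s t : 0 <= dstring d s t.
Proof. by apply: sumr_ge0 => i _; exact: dterm_ge0. Qed.

Lemma sum_half_powers n : \sum_(i < n) 2 ^- i.+1 = 1 - 2 ^- n :> R.
Proof.
elim: n => [|n IH]; first by rewrite big_ord0 expr0 invr1 subrr.
rewrite big_ord_recr /= IH -addrA; congr (1 + _).
by rewrite {1}[2 ^- n]splitr exprSr invfM opprD addrNK.
Qed.

Lemma dstring_le1 s t : dstring d s t <= 1.
Proof.
apply: (@le_trans _ _ (\sum_(i < maxn (size s) (size t)) 2 ^- i.+1)).
  apply: ler_sum => i _; case/andP: (dletter_bounds (onth s i) (onth t i)) => _ h.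
  by rewrite ler_piMr // invr_ge0 exprn_ge0.
by rewrite sum_half_powers gerBl invr_ge0 exprn_ge0.
Qed.

Lemma onth_take (T : Type) n (s : seq T) i :
  onth (take n s) i = if (i < n)%N then onth s i else None.
Proof. by elim: n s i => [|n IH] [|x s] [|i] //=; rewrite ?IH ?ltnS //; case: ifP. Qed.

(** Terms of index below [n] are unchanged by truncation, and the terms that disappear are
    nonnegative. *)
Lemma dstring_take n s t : dstring d (take n s) (take n t) <= dstring d s t.
Proof.
rewrite /dstring.
have szle : (maxn (size (take n s)) (size (take n t)) <= maxn (size s) (size t))%N.
  by rewrite geq_max !leq_max !size_take_min !geq_minr orbT.
rewrite -!(big_mkord xpredT (fun i => 2 ^- i.+1 * dletter d (onth _ i) (onth _ i))).
rewrite (big_cat_nat (leq0n _) szle) //= ler_wpDr //.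
  by apply: sumr_ge0 => i _; exact: dterm_ge0.
apply: ler_sum => i _; rewrite !onth_take; case: ifP => // _.
by rewrite mulr0 dterm_ge0.
Qed.

Lemma dpoint_le_dstring s A a : A a -> dpoint d s A <= dstring d s a.
Proof.
move=> Aa; rewrite /dpoint ifF; last by apply/negP => /eqP A0; rewrite A0 in Aa.
apply: ge_inf; last by exists a.
by exists 0 => _ [t _ <-]; exact: dstring_ge0.
Qed.

Lemma dpoint_le1 s A : dpoint d s A <= 1.
Proof.
have [->|/set0P[a Aa]] := eqVneq A set0; first by rewrite /dpoint eqxx.
exact: le_trans (dpoint_le_dstring s Aa) (dstring_le1 _ _).
Qed.

(** Cutting an element of [A] at [size s] brings it no further from [s] but may leave [A], hence a
    witness in [pclosure A]. It minimizes the distance over a finite type. *)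
Lemma dpoint_attained s A c : A !=set0 -> dpoint d s A <= c ->
  exists a, [/\ pclosure A a, (size a <= size s)%N & dstring d s a <= c].
Proof.
move=> A0 sAc; pose P (a : (size s).-bseq E) := `[< pclosure A a >].
have P0 : P [bseq] by apply/asboolP; exact: pclosure_nil.
case: (Order.TotalTheory.arg_minP (fun a : (size s).-bseq E => dstring d s a) P0).
move=> a /asboolP Aa amin; exists a; split=> //; first exact: size_bseq.
apply: le_trans sAc; rewrite /dpoint ifF; last by apply/negbTE/set0P.
apply: lb_le_inf => [|_ [t At <-]]; first by case: A0 => t At; exists (dstring d s t), t.
have szt : (size (take (size s) t) <= size s)%N by rewrite size_take_min geq_minl.
have Pt : P (Bseq szt) by apply/asboolP/pclosure_take/pclosure_sub.
apply: le_trans (amin _ Pt) _ => /=.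
by rewrite -{1}[s]take_size dstring_take.
Qed.

Lemma dlang_le A B c : 0 <= c ->
  dlang d A B <= c <->
  (forall a, A a -> dpoint d a B <= c) /\ (forall b, B b -> dpoint d b A <= c).
Proof.
move=> c0.
have supP (X Y : set (seq E)) :
    sup [set dpoint d x Y | x in X] <= c <-> forall x, X x -> dpoint d x Y <= c.
  split=> [h x Xx|h].
    apply: le_trans h; apply: ub_le_sup; last by exists x.
    by exists 1 => _ [y _ <-]; exact: dpoint_le1.
  (* The supremum over the empty set is 0; this case uses [0 <= c]. *)
  have [->|/set0P[x Xx]] := eqVneq X set0; first by rewrite image_set0 sup0.
  by apply: ge_sup => [|_ [y Xy <-]]; [exists (dpoint d x Y), x|exact: h].
rewrite /dlang ge_max; split=> [/andP[/supP ? /supP ?] //|[? ?]].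
by apply/andP; split; apply/supP.
Qed.

End Distances.

(** * Admissible languages *)

Section OptimalControl.
Variables (R : realType) (E : finType) (G : automaton E) (Euc : {set E}).
Variables (d : E -> E -> R) (lam : R) (K : set (seq E)).
Hypotheses (hd : unit_metric d) (lam_ge0 : 0 <= lam).
Hypotheses (K_nonempty : K !=set0) (K_closed : pclosure K = K).
Implicit Types (s t b : seq E) (M N : set (seq E)) (S : control_map G).

(** For nonempty prefix closed [M] this amounts to [dpoint d s M <= lam], and an explicit witness
    can be truncated. *)
Definition close_to s M : Prop := exists2 a, M a & dstring d s a <= lam.

(** These turn out to be exactly the closed-loop languages of supervisors within [lam] of [K]. *)
Definition admissible M : Prop :=
  [/\ M [::], pclosure M = M, controllable G Euc M,
      forall s, M s -> close_to s K & forall b, K b -> close_to b M].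

Lemma dpoint_close s M : M !=set0 -> dpoint d s M <= lam -> close_to s (pclosure M).
Proof. by move=> M0 /(dpoint_attained hd M0)[a [? _ ?]]; exists a. Qed.

Lemma close_dpoint s M : close_to s M -> dpoint d s M <= lam.
Proof. by case=> a Ma; apply: le_trans; exact: dpoint_le_dstring. Qed.

Lemma admissible_dlang M : admissible M -> dlang d M K <= lam.
Proof.
case=> _ _ _ MK KM; apply/(dlang_le hd) => //.
by split=> s ?; apply: close_dpoint; [exact: MK|exact: KM].
Qed.

Lemma pclosure_admissible M : M !=set0 -> controllable G Euc M ->
  dlang d M K <= lam -> admissible (pclosure M).
Proof.
move=> M0 [MG Mc] /(dlang_le hd _ _ lam_ge0)[MK KM]; split.
- exact: pclosure_nil.
- exact: pclosure_idem.
- split; last by rewrite pclosure_idem.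
  by rewrite -pclosure_lang => s [t Mt st]; exists t => //; exact: MG.
- move=> s [t Mt /prefixP[u tE]].
  (* The prefix [s] of [t] is served by a string of [K] near [t], cut at the length of [s]. *)
  have [a Ka ta] := dpoint_close K_nonempty (MK _ Mt).
  exists (take (size s) a); first by rewrite -K_closed; exact: pclosure_take.
  apply: le_trans ta; rewrite -[X in dstring d X _](take_size_cat u (erefl (size s))) -tE.
  exact: dstring_take.
- by move=> b Kb; apply: dpoint_close => //; exact: KM.
Qed.

Lemma lambda_controllable_admissible :
  lambda_controllable d G Euc lam K -> exists M, admissible M.
Proof.
case=> KG [M Mc MK].
have [M0|/set0P M0] := eqVneq M set0; last by exists (pclosure M); exact: pclosure_admissible.
(* No supervisor generates the empty language. Any point of [K] is at distance 1 from it, so [lam]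
   is at least 1; then [lang G] is admissible, as strings are never more than 1 apart. *)
have lam1 : 1 <= lam.
  have [b Kb] := K_nonempty.
  have [_ /(_ b Kb)] := (dlang_le hd M K lam_ge0).1 MK.
  by rewrite M0 /dpoint eqxx.
have close1 s N : N !=set0 -> close_to s N.
  by case=> a Na; exists a => //; apply: le_trans lam1; exact: dstring_le1.
exists (lang G); split=> //; rewrite ?pclosure_lang //.
- by split=> // s []; rewrite pclosure_lang.
- by move=> s _; exact: close1.
- by move=> b _; apply: close1; exists [::].
Qed.

(** * Closed-loop languages of supervisors *)

Lemma closed_loop_lang S : closed_loop S `<=` lang G.
Proof. by move=> s; case. Qed.

Lemma closed_loop_pclosure S : pclosure (closed_loop S) = closed_loop S.
Proof.
apply/seteqP; split=> [s [t Lt]|]; last exact: pclosure_sub.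
elim: Lt s => [|{}t Gt a Lt IH Gta aS] s.
  by rewrite prefixs0 => /eqP ->; exact: closed_loop_nil.
case/prefix_rconsP => [->|]; last exact: IH.
exact: closed_loop_rcons aS.
Qed.

Lemma closed_loop_controllable S :
  supervisor Euc S -> controllable G Euc (closed_loop S).
Proof.
move=> SE; split; first exact: closed_loop_lang.
rewrite closed_loop_pclosure => _ [[s [a [Ls aE ->]]] Gsa].
by apply: (@closed_loop_rcons _ _ _ s (closed_loop_lang Ls)) => //; exact: (fintype.subsetP (SE _)).
Qed.

Lemma closed_loop_admissible S :
  supervisor Euc S -> dlang d (closed_loop S) K <= lam -> admissible (closed_loop S).
Proof.
move=> SE SK; rewrite -closed_loop_pclosure; apply: pclosure_admissible => //.
  by exists [::]; exact: closed_loop_nil.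
exact: closed_loop_controllable.
Qed.

Lemma admissible_closed_loop M : admissible M ->
  exists2 S : control_map G, supervisor Euc S & closed_loop S = M.
Proof.
case=> M0 Mcl [MG Mc] _ _.
(* Enable [Euc] and the continuations inside [M]; by controllability, enabling [Euc] never leads out
   of [M]. *)
exists (fun s : {s : seq E | accepted G s} =>
          (Euc :|: [set a | `[< M (rcons (sval s) a) >]])%SET).
  by move=> s; exact: finset.subsetUl.
apply/seteqP; split=> s.
  elim=> [//|{}s Gs a _ Ms Gsa]; rewrite !inE /= => /orP[aE|/asboolP //].
  by rewrite -Mcl; apply: Mc; split=> //; exists s, a; rewrite Mcl.
elim/last_ind: s => [_|s a IH Msa]; first exact: closed_loop_nil.
have Ms := pclosure_rcons Mcl Msa.
apply: (@closed_loop_rcons _ _ _ s (MG _ Ms)); [exact: IH|exact: MG|].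
by rewrite !inE /=; apply/orP; right; apply/asboolP.
Qed.

(** * The Pareto order and limits of its chains *)

Definition improves M N : Prop := M `&` K `<=` N `&` K /\ N `\` K `<=` M `\` K.

Lemma improves_refl M : improves M M.
Proof. by split. Qed.

Lemma improves_trans M1 M2 M3 : improves M1 M2 -> improves M2 M3 -> improves M1 M3.
Proof.
by move=> [c12 d12] [c23 d23]; split; [exact: subset_trans c23|exact: subset_trans d12].
Qed.

Section Chain.
Variable C : set (set (seq E)).
Hypotheses (C_admissible : forall M, C M -> admissible M) (C_nonempty : C !=set0).
Hypothesis C_total : total_on C improves.

(** Membership in the filter generated by the tails of [C]. *)
Definition eventually (P : set (seq E) -> Prop) : Prop :=
  exists2 M, C M & forall N, C N -> improves M N -> P N.

Lemma eventually_and (P Q : set (seq E) -> Prop) :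
  eventually P -> eventually Q -> eventually (fun M => P M /\ Q M).
Proof.
move=> [M CM MP] [N CN NQ].
case: (C_total CM CN) => h; [exists N|exists M] => // L CL hL; split.
- by apply: MP => //; exact: improves_trans hL.
- exact: NQ.
- exact: MP.
- by apply: NQ => //; exact: improves_trans hL.
Qed.

(** Finitely many thresholds have a latest one. *)
Lemma eventually_all (T : finType) (P : T -> set (seq E) -> Prop) :
  (forall x, eventually (P x)) -> eventually (fun M => forall x, P x M).
Proof.
move=> evP.
suff [M CM MP] : eventually (fun M => forall x, x \in enum T -> P x M).
  by exists M => // N CN MN x; apply: MP => //; rewrite mem_enum.
elim: (enum T) => [|x l IH]; first by have [M CM] := C_nonempty; exists M.
have [M CM Mxl] := eventually_and (evP x) IH.
exists M => // N CN MN y; rewrite inE; have [Nx Nl] := Mxl N CN MN.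
by case/orP => [/eqP ->|/Nl].
Qed.

Lemma eventually_ex (P : set (seq E) -> Prop) : eventually P -> exists2 M, C M & P M.
Proof. by case=> M CM MP; exists M => //; apply: MP => //; exact: improves_refl. Qed.

(** Explicitly, the union of the parts inside [K] and the intersection of the parts outside [K],
    over all members of the chain. *)
Definition chain_limit : set (seq E) := [set s | eventually (fun M => M s)].

(** Along the chain a string of [K] can only enter and any other string can only leave. *)
Lemma eventually_in_or_out s : chain_limit s \/ eventually (fun M => ~ M s).
Proof.
have [?|nLs] := pselect (chain_limit s); [by left|right].
have [Ks|nKs] := pselect (K s).
  have [M CM] := C_nonempty; exists M => // N CN _ Ns; apply: nLs.
  by exists N => // P CP [/(_ s)NP _]; case: NP.
have [M CM nMs] : exists2 M, C M & ~ M s.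
  apply: contrapT => h; apply: nLs; have [M CM] := C_nonempty.
  by exists M => // N CN _; apply: contrapT => nNs; apply: h; exists N.
by exists M => // N CN [_ /(_ s)NM] Ns; case: NM.
Qed.

Lemma chain_limit_improves M : C M -> improves M chain_limit.
Proof.
move=> CM; split=> s [].
  by move=> Ms Ks; split=> //; exists M => // N CN [/(_ s)MN _]; case: MN.
move=> [N CN Ns] nKs; split=> //.
(* If [N] comes after [M], then [s] lies in [N] outside [K], hence in [M]; otherwise [M] is itself
   past the threshold [N]. *)
case: (C_total CM CN) => [[_ /(_ s)]|NM]; last exact: Ns.
by case=> //; split=> //; apply: Ns => //; exact: improves_refl.
Qed.

Lemma chain_limit_close b : K b -> close_to b chain_limit.
Proof.
move=> Kb; apply: contrapT => nclose.
(* [P a M] says that [a] is no witness of [close_to b M]. It holds eventually for each [a]: one in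
   the limit is too far from [b], any other is eventually absent. *)
pose P (a : (size b).-bseq E) M := M a -> ~ dstring d b a <= lam.
have evP a : eventually (P a).
  case: (eventually_in_or_out a) => [La|[M CM Ma]].
    have [M CM _] := La; exists M => // N _ _ _ ba.
    by apply: nclose; exists (val a).
  by exists M => // N CN MN /(Ma _ CN MN).
have [M CM allP] := eventually_ex (eventually_all evP).
have [M0 Mcl _ _ KM] := C_admissible CM.
have bM : dpoint d b M <= lam by exact/close_dpoint/KM.
have [|a [Ma sza ba]] := dpoint_attained hd _ bM; first by exists [::].
by apply: (allP (Bseq sza)) ba; rewrite -Mcl.
Qed.

Lemma chain_limit_admissible : admissible chain_limit.
Proof.
have Lcl : pclosure chain_limit = chain_limit.
  apply/seteqP; split; last exact: pclosure_sub.
  move=> s [t [M CM Mt] st]; exists M => // N CN MN.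
  by have [_ <- _ _ _] := C_admissible CN; exists t => //; exact: Mt.
split=> //.
- by have [M CM] := C_nonempty; exists M => // N CN _; case: (C_admissible CN).
- split.
    move=> s /eventually_ex[M CM Ms].
    by have [_ _ [MG _] _ _] := C_admissible CM; exact: MG.
  (* The threshold for [s] also serves its uncontrollable extension, since each later language is
     controllable. *)
  rewrite Lcl => _ [[s [a [[M CM Ms] aE ->]]] Gsa]; exists M => // N CN MN.
  have [_ Ncl [_ Nc] _ _] := C_admissible CN.
  by rewrite -Ncl; apply: Nc; split=> //; exists s, a; split=> //; rewrite Ncl; exact: Ms.
- move=> s /eventually_ex[M CM Ms].
  by have [_ _ _ MK _] := C_admissible CM; exact: MK.
- exact: chain_limit_close.
Qed.

End Chain.

(** * Maximal elements and Pareto optimality *)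

Lemma exists_maximal_admissible M0 : admissible M0 ->
  exists2 M, admissible M & forall N, admissible N -> improves M N -> improves N M.
Proof.
move=> adm0; pose T := {M | admissible M}.
pose le (M N : T) := `[< improves (sval M) (sval N) >].
have [||A Atot|M Mmax] := @ZL_preorder T (exist _ M0 adm0) le.
- by move=> M; apply/asboolP; exact: improves_refl.
- move=> M2 M1 M3 /asboolP h /asboolP h'; apply/asboolP; exact: improves_trans h'.
(* The limit needs a nonempty chain; the empty one is bounded by [M0]. *)
- have [A0|/set0P[M AM]] := eqVneq A set0; first by exists (exist _ M0 adm0); rewrite A0.
  pose C : set (set (seq E)) := sval @` A.
  have Cadm N : C N -> admissible N by case=> P _ <-; exact: svalP.
  have C0 : C !=set0 by exists (sval M), M.
  have Ctot : total_on C improves.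
    move=> _ _ [N AN <-] [P AP <-].
    by case: (Atot _ _ AN AP) => /asboolP; [left|right].
  exists (exist _ _ (chain_limit_admissible Cadm C0 Ctot)) => N AN.
  by apply/asboolP/chain_limit_improves => //; exists N.
- exists (sval M); first exact: svalP.
  by move=> N Nadm /asboolP MN; apply/asboolP; exact: (Mmax (exist _ N Nadm) MN).
Qed.

(** The inclusions required of a rival [S'] say that it improves on [S]; maximality reverses them,
    so neither is strict. *)
Lemma maximal_pareto_optimal S :
  (forall N, admissible N -> improves (closed_loop S) N -> improves N (closed_loop S)) ->
  pareto_optimal d Euc lam K S.
Proof.
move=> Smax [S' [S'E S'K cSS' dSS' strict]].
have [cS'S dS'S] := Smax _ (closed_loop_admissible S'E S'K) (conj cSS' dSS').
by case: strict => -[_]; apply.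
Qed.

End OptimalControl.

Theorem theorem5 (R : realType) (E : finType) (G : automaton E)
    (Euc : {set E}) (d : E -> E -> R) (lam : R) (K : set (seq E))
    (hd : unit_metric d) (hlam : 0 <= lam <= 1)
    (K_sub : K `<=` lang G) (K_nonempty : K !=set0)
    (K_closed : pclosure K = K) :
  (exists S : control_map G, OCP_solution d Euc lam K S) <->
  lambda_controllable d G Euc lam K.
Proof.
have /andP[lam_ge0 _] := hlam; split=> [[S [SE SK _]]|Kc].
  by split=> //; exists (closed_loop S) => //; exact: closed_loop_controllable.
have [M0 adm0] := lambda_controllable_admissible hd lam_ge0 K_nonempty K_closed Kc.
have [M admM Mmax] := exists_maximal_admissible hd adm0.
have [S SE SM] := admissible_closed_loop admM.
exists S; split=> //; first by rewrite SM; exact: admissible_dlang admM.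
by apply: maximal_pareto_optimal => //; rewrite SM.
Qed.
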